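(* Let $q$ be a prime power, let $m\ge 2$, and let $S$ be a set of lattice points in $K_q^m=[0,q-2]^m\subset\mathbb{R}^m$. Let $\pi_m:\mathbb{R}^m\to\mathbb{R}$ be the projection to the last coordinate, suppose $\pi_m(S)=\{0,1,\dots,\ell\}$ for some integer $\ell\ge 0$, and let $S_0,\dots,S_\ell$ be the corresponding fibers, $S_i=S\cap\pi_m^{-1}(i)$, viewed as subsets of $\mathbb{Z}^{m-1}$ by dropping the last coordinate. Suppose there is a primitive lattice segment $[a,b]\subset\mathbb{R}^{m-1}$ such that for every $1\le i\le\ell$ the set $S_i+\{a,b\}$ is contained in $S_{i-1}$ up to a lattice translation, i.e. there is $v_i\in\mathbb{Z}^{m-1}$ with $S_i+\{a,b\}+v_i\subseteq S_{i-1}$. Then $$d(S)=(q-1)\,d(S_0).$$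
   Context: $\mathbb{F}_q$ is the finite field with $q$ elements and $\mathbb{F}_q^*=\mathbb{F}_q\setminus\{0\}$. For $r\ge 1$ let $K_q^r=[0,q-2]^r\subset\mathbb{R}^r$. For a nonempty set $A\subseteq K_q^r\cap\mathbb{Z}^r$, let $\mathcal{L}(A)=\operatorname{span}_{\mathbb{F}_q}\{t^a : a\in A\}$, where $t^a=t_1^{a_1}\cdots t_r^{a_r}$. The generalized toric code $\mathcal{C}_A$ is the image of the evaluation map $\mathcal{L}(A)\to\mathbb{F}_q^{(q-1)^r}$, $f\mapsto (f(p))_{p\in(\mathbb{F}_q^* )^r}$. This map is injective because $A\subseteq K_q^r$. The minimum distance $d(A)=d(\mathcal{C}_A)$ is the minimum weight (number of nonzero entries) of a nonzero codeword. Equivalently, it is the minimum over nonzero $f\in\mathcal{L}(A)$ of the number of points of $(\mathbb{F}_q^* )^r$ at which $f$ does not vanish. Here $d(S)$ is computed in $\mathbb{R}^m$ and $d(S_0)$ in $\mathbb{R}^{m-1}$. A lattice segment is a segment $[a,b]$ with distinct endpoints in the integer lattice; it is primitive if it contains exactly two lattice points (namely $a$ and $b$). Sums of sets are Minkowski sums: $A+B=\{x+y : x\in A,\ y\in B\}$. *)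

(* Defs.v *)
From mathcomp Require Import all_boot all_order all_algebra.
From mathcomp Require Import finmap.
From mathcomp Require Import mpoly.

Set Implicit Arguments.
Unset Strict Implicit.
Unset Printing Implicit Defensive.

Import Order.TTheory GRing.Theory Num.Theory.
Local Open Scope ring_scope.

Definition in_box (q r : nat) (x : 'rV[int]_r) : bool :=
  [forall j, 0 <= x 0 j <= q%:Z - 2].

(* The exponents are read through absolute values, which is t^a only when a
   has nonnegative coordinates, as it has in the box K_q^r. *)
Definition monomial (F : finFieldType) (r : nat) (a : 'rV[int]_r)
    : {mpoly F[r]} :=
  'X_[[multinom absz (a 0%R j) | j < r]].

(* L(A) is the set of all [lincomb c]. *)
Definition lincomb (F : finFieldType) (r : nat) (A : {fset 'rV[int]_r})
    (c : {ffun A -> F}) : {mpoly F[r]} :=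
  \sum_(a : A) c a *: monomial F (val a).

Definition torus (F : finFieldType) (r : nat) : finType :=
  {ffun 'I_r -> {unit F}}.

Definition evaluation (F : finFieldType) (r : nat) (f : {mpoly F[r]})
    : {ffun torus F r -> F} :=
  [ffun p : torus F r => f.@[fun j => val (p j)]].

Definition toric_code (F : finFieldType) (r : nat) (A : {fset 'rV[int]_r})
    : {set {ffun torus F r -> F}} :=
  [set evaluation (lincomb c) | c : {ffun A -> F}].

Definition weight (F : finFieldType) (T : finType) (w : {ffun T -> F}) : nat :=
  #|[set p | w p != 0]|.

(* The default value #|T| bounds every weight, so it matters only for a code
   without nonzero words. *)
Definition min_distance (F : finFieldType) (T : finType)
    (C : {set {ffun T -> F}}) : nat :=
  \big[Order.min/#|T|]_(w in C | w != 0) weight w.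

Definition toric_distance (F : finFieldType) (r : nat)
    (A : {fset 'rV[int]_r}) : nat :=
  min_distance (toric_code F A).

Definition last_coord (n : nat) (x : 'rV[int]_n.+1) : int := x 0 ord_max.

Definition fiber (n : nat) (S : {fset 'rV[int]_n.+1}) (i : int)
    : {fset 'rV[int]_n} :=
  [fset col' ord_max x | x in S & last_coord x == i]%fset.

Definition minkowski (n : nat) (A B : {fset 'rV[int]_n}) : {fset 'rV[int]_n} :=
  [fset (x + y)%R | x in A, y in B]%fset.

(* R plays the role of the real numbers; only the parameter of the segment lives
   there, so any ordered field will do. *)
Definition on_segment (R : realFieldType) (n : nat) (a b x : 'rV[int]_n)
    : Prop :=
  exists t : R, 0 <= t <= 1 /\
    map_mx intr x = (1 - t) *: map_mx intr a + t *: map_mx intr b.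

Definition primitive_segment (R : realFieldType) (n : nat) (a b : 'rV[int]_n)
    : Prop :=
  a != b /\ forall x, on_segment R a b x <-> x = a \/ x = b.

(* Main.v *)
(* Write f in L(S) as sum_i f_i t_m^i and let k be the largest index with f_k <> 0.
   Over every point where f_k does not vanish, f is a polynomial of degree k in
   t_m, so wt(f) >= (q-1-k) wt(f_k).  On the other hand, multiplying f_k by k
   binomials t^b - g t^a with distinct g in F_q^* gives, up to a monomial, a
   nonzero element of L(S_0), which also vanishes where t^(b-a) takes one of the
   values g.  Averaging over the choice of these values,
   d(S_0) <= wt(f_k) (q-1-k)/(q-1) for a suitable choice, hence
   wt(f) >= (q-1) d(S_0).  Equality is attained by elements of L(S_0). *)
Require Import Defs.
From mathcomp Require Import all_boot all_order all_algebra all_fingroup all_solvable.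
From mathcomp Require Import finmap.
From mathcomp Require Import mpoly.
From mathcomp Require Import finfield.

Import Order.TTheory GRing.Theory Num.Theory.
Local Open Scope ring_scope.

(** * Characters of the torus and Laurent polynomials as functions on it *)

Section Characters.
Variable F : finFieldType.

(** The Laurent monomial t^x as a function on the torus. Integer powers allow negative exponents, so
    exponent sets can be translated freely. *)
Definition chi {r : nat} (x : 'rV[int]_r) (p : torus F r) : F :=
  \prod_j val (p j) ^ x 0 j.

Lemma unit_neq0 (u : {unit F}) : val u != 0.
Proof. by rewrite -unitfE (valP u). Qed.

Lemma chi_neq0 r (x : 'rV[int]_r) p : chi x p != 0.
Proof. by apply/prodf_neq0 => j _; rewrite expfz_neq0 // unit_neq0. Qed.

Lemma chiD r (x y : 'rV[int]_r) p : chi (x + y) p = chi x p * chi y p.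
Proof.
rewrite /chi -big_split; apply: eq_bigr => j _.
by rewrite mxE expfzDr // unit_neq0.
Qed.

(** Translation by 1 permutes [F], so the sum of all elements is unchanged when [#|F|] ones are
    added to it. *)
Lemma card_natr_eq0 : #|F|%:R = 0 :> F.
Proof.
have : \sum_(x : F) x = \sum_(x : F) x + \sum_(x : F) 1.
  by rewrite -big_split [LHS](reindex_inj (addIr 1)).
by rewrite sumr_const -{1}[LHS]addr0 => /addrI <-.
Qed.

(** If q-1 divides k, all q-1 terms are 1 and q-1 = -1 in [F]. Otherwise a generator of the cyclic
    unit group shows that g^k <> 1 for some g, and multiplication by g permutes the units while
    scaling the sum by g^k. *)
Lemma sum_unit_expz (k : int) :
  \sum_(u : {unit F}) val u ^ k = if (#|F|.-1%:Z %| k)%Z then -1 else 0.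
Proof.
case: ifPn => [/dvdzP[z ->]|ndvd].
  have uq (u : {unit F}) : val u ^ (z * #|F|.-1%:Z) = 1.
    rewrite mulrC -exprz_exp -exprnP -card_finField_unit -FinRing.val_unitX.
    by rewrite expg_cardG ?inE // exp1rz.
  under eq_bigr do rewrite uq.
  rewrite sumr_const -cardsT card_finField_unit.
  apply/eqP; rewrite -addr_eq0 -mulrSr prednK ?card_natr_eq0 //.
  by apply/card_gt0P; exists 0.
have [g hg] : exists g : {unit F}, val g ^ k != 1.
  apply/existsP; apply: contraNT ndvd => /existsPn h.
  have /cyclicP[g gE] := field_unit_group_cyclic [set: {unit F}]%G.
  have og : #[g]%g = #|F|.-1 by rewrite -card_finField_unit orderE gE.
  rewrite /dvdz /= unfold_in /= -og order_dvdn -val_eqE FinRing.val_unitX /=.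
  move/negPn/eqP: (h g); case: k {h} => k //= hk; first by rewrite -hk.
  by apply/eqP/invr_inj; rewrite invr1; exact: hk.
have : val g ^ k * \sum_(u : {unit F}) val u ^ k = \sum_(u : {unit F}) val u ^ k.
  rewrite mulr_sumr [RHS](reindex_inj (mulgI g)) /=.
  by apply: eq_bigr => u _; rewrite expfzMl.
move/eqP; rewrite -subr_eq0 -[X in _ - X]mul1r -mulrBl mulf_eq0 subr_eq0.
by rewrite (negbTE hg) => /eqP.
Qed.

(** Coefficients form a function on the whole lattice, of which only the values on [A] count;
    translating exponents is then a change of argument. *)
Definition laurent {r} (A : {fset 'rV[int]_r}) (c : 'rV[int]_r -> F)
    (p : torus F r) : F :=
  \sum_(x <- A) c x * chi x p.

(** Each coordinate lies in [0, q-2], a full set of residues modulo q-1. *)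
Lemma in_box_eq q r (x y : 'rV[int]_r) : in_box q x -> in_box q y ->
  (forall j, (q.-1%:Z %| x 0%R j - y 0%R j)%Z) -> x = y.
Proof.
move=> /forallP hx /forallP hy h; apply/rowP => j.
move: (hx j) (hy j) (h j); move: (x 0 j) (y 0 j) => a b /andP[a0 aq] /andP[b0 bq].
rewrite -eqz_mod_dvd.
have q2 : (1 < q)%N.
  by move: (le_trans a0 aq); rewrite subr_ge0.
have lt_q z : z <= q%:Z - 2 -> z < q.-1%:Z.
  move=> hz; apply: le_lt_trans hz _; rewrite -subn1 -subzn ?(ltnW q2) //.
  by rewrite ltrD2l.
by rewrite !modz_small ?a0 ?b0 ?lt_q // => /eqP.
Qed.

(* Orthogonality of characters: the coefficient at [y] is recovered, up to
   sign, by summing the function against [chi (- y)] over the torus. *)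
Lemma laurent_neq0 r (A : {fset 'rV[int]_r}) (c : 'rV[int]_r -> F) y :
  (forall x, x \in A -> in_box #|F| x) -> y \in A -> c y != 0 ->
  exists p, laurent A c p != 0.
Proof.
move=> hA yA cy; apply/existsP; apply: contraNT cy.
rewrite negb_exists => /forallP h0.
have orth x : x \in A -> x != y ->
    \sum_(p : torus F r) chi (x - y) p = 0.
  move=> xA; apply: contraNeq => hs; apply/eqP.
  apply: in_box_eq (hA _ xA) (hA _ yA) _ => j.
  move: hs; rewrite /chi -(bigA_distr_bigA (fun j (u : {unit F}) => val u ^ (x - y) 0 j)).
  move/prodf_neq0/(_ j isT); rewrite sum_unit_expz !mxE.
  by case: ifP => //; rewrite eqxx.
have : \sum_p laurent A c p * chi (- y) p = 0.
  by apply: big1 => p _; move/negPn/eqP: (h0 p) => ->; rewrite mul0r.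
under eq_bigr do rewrite /laurent mulr_suml.
rewrite exchange_big /= (big_fsetD1 y) //= [X in _ + X]big_seq.
rewrite [X in _ + X](_ : _ = 0) ?addr0; last first.
  apply: big1 => x; rewrite !inE => /andP[xy xA].
  under eq_bigr do rewrite -mulrA -chiD.
  by rewrite -mulr_sumr orth // mulr0.
under eq_bigr do rewrite -mulrA -chiD subrr.
rewrite -mulr_sumr => /eqP; rewrite mulf_eq0 => /orP[//|].
(* The diagonal sum factors over the coordinates into (-1)^r, which is nonzero. *)
rewrite /chi -(bigA_distr_bigA (fun j (u : {unit F}) => val u ^ (0 : 'rV[int]_r) 0 j)).
move/eqP => hp; have : \prod_(i < r) (-1 : F) = 0.
  rewrite -[RHS]hp; apply: eq_bigr => j _.
  by rewrite sum_unit_expz mxE dvdz0.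
by move/eqP; rewrite prodr_const expf_eq0 oppr_eq0 oner_eq0 andbF.
Qed.

(** Since [c] vanishes off [A], only the translate A + w contributes to the sum over [B]. *)
Lemma laurent_shift r (A B : {fset 'rV[int]_r}) c w p :
  (forall x, x \in A -> x + w \in B) -> (forall x, x \notin A -> c x = 0) ->
  \sum_(y <- B) c (y - w) * chi y p = chi w p * laurent A c p.
Proof.
move=> AB cA; rewrite /laurent mulr_sumr.
have -> : \sum_(y <- B) c (y - w) * chi y p =
          \sum_(y <- [fset (x + w)%R | x in A]%fset) c (y - w) * chi y p.
  apply/esym; apply: big_fset_incl.
    by apply/fsubsetP => _ /imfsetP[x xA ->]; apply: AB.
  move=> y _ yA; rewrite cA ?mul0r //; apply: contra yA => yA.
  by apply/imfsetP; exists (y - w) => //; rewrite subrK.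
rewrite big_imfset /=; last by move=> x y _ _; apply: addIr.
by apply: eq_bigr => x _; rewrite addrK chiD mulrA mulrC.
Qed.

(* The Laurent polynomials form a domain: if the product with [t^b - g t^a]
   vanished, the support of [c] would be stable under translation by [b - a]. *)
Lemma mul_binomial r (A B : {fset 'rV[int]_r}) (a b v : 'rV[int]_r)
    (c : 'rV[int]_r -> F) (g : F) :
  a != b -> g != 0 ->
  (forall x, x \in A -> x + a + v \in B /\ x + b + v \in B) ->
  (exists2 x, x \in A & c x != 0) ->
  exists2 d, exists2 y, y \in B & d y != 0 &
    forall p, laurent B d p =
      chi v p * (chi b p - g * chi a p) * laurent A c p.
Proof.
move=> ab g0 AB [x0 x0A cx0].
pose c0 x := if x \in A then c x else 0.
have c0A x : x \notin A -> c0 x = 0 by rewrite /c0 => /negbTE ->.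
(* The coefficients of t^v (t^b - g t^a) times the polynomial with coefficients [c0]. *)
pose d y := c0 (y - (b + v)) - g * c0 (y - (a + v)).
exists d; last first.
  move=> p; rewrite /laurent.
  under eq_bigr do rewrite mulrBl -mulrA.
  rewrite sumrB -mulr_sumr.
  rewrite (@laurent_shift _ A) //; last by move=> x /AB []; rewrite addrA.
  rewrite (@laurent_shift _ A) //; last by move=> x /AB []; rewrite addrA.
  have -> : laurent A c0 p = laurent A c p.
    by rewrite /laurent big_seq [RHS]big_seq; apply: eq_bigr => x xA; rewrite /c0 xA.
  rewrite !chiD /laurent; move: (\sum_(_ <- _) _) => z.
  rewrite [chi b p * _]mulrC [chi a p * _]mulrC mulrBr mulrBl !mulrA.
  by rewrite [g * chi v p]mulrC.
suff : has (fun y => d y != 0) B by case/hasP => y yB dy; exists y.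
apply: contraT => /hasPn hd.
(* Vanishing of [d] at x + b + v reads c0(x) = g c0(x + b - a). *)
have hstep x : c0 x != 0 -> c0 (x + (b - a)) != 0.
  move=> cx; have xA : x \in A by apply: contraNT cx => /c0A ->.
  have [_ xB] := AB _ xA.
  move/hd: xB; rewrite /d negbK -(addrA x) addrK subr_eq0 => /eqP e.
  move: cx; rewrite e mulf_eq0 negb_or => /andP[_].
  by rewrite opprD [- a - v]addrC -addrA [b + v + _]addrA addrK.
have [j hj] : exists j, (b - a) 0 j != 0.
  by apply/existsP; apply: contraNT ab => /existsPn h; apply/eqP/rowP => j;
     move/negPn/eqP: (h j); rewrite !mxE => /eqP; rewrite subr_eq0 => /eqP.
(* The progression x0 + k(b - a) would put infinitely many points in the finite set [A]. *)
pose m (k : nat) := x0 + (b - a) *+ k.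
have hm k : c0 (m k) != 0.
  elim: k => [|k IH]; first by rewrite /m mulr0n addr0 /c0 x0A.
  by rewrite /m mulrSr addrA; apply: hstep.
have minj : injective m.
  move=> k k' /addrI /(congr1 (fun z : 'rV_r => z 0 j)); rewrite !mulmxnE.
  by rewrite -[_ *+ k]mulr_natr -[_ *+ k']mulr_natr => /(mulfI hj)/eqP; rewrite eqr_nat => /eqP.
have mA k : m k \in A by apply: contraNT (hm k) => /c0A ->.
have : (size [seq m k | k <- iota 0 (size A).+1] <= size A)%N.
  apply: uniq_leq_size; first by rewrite map_inj_uniq // iota_uniq.
  by move=> _ /mapP[k _ ->]; apply: mA.
by rewrite size_map size_iota ltnn.
Qed.

End Characters.

(** [C] is built greedily: among the values of [V] not yet chosen, add one whose preimage in the
    surviving part of [D] is at least average. *)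
Lemma avoid_values (T U : finType) (h : T -> U) (D : {set T}) (V : {set U})
    (k : nat) :
  (forall t, t \in D -> h t \in V) -> (k <= #|V|)%N ->
  exists C : {set U}, [/\ C \subset V, #|C| = k &
    (#|V| * #|[set t in D | h t \notin C]| <= (#|V| - k) * #|D|)%N].
Proof.
move=> hD; elim: k => [|k IH] hk.
  exists set0; rewrite sub0set cards0 subn0; split=> //.
  by rewrite leq_mul2l subset_leq_card ?orbT //; apply/subsetP => t; rewrite inE => /andP[].
have [C [CV Ck hC]] := IH (ltnW hk).
set D' := [set t in D | _] in hC.
have cVC : #|V :\: C| = (#|V| - k)%N by rewrite cardsD (setIidPr CV) Ck.
have D'E : #|D'| = (\sum_(u in V :\: C) #|[set t in D' | h t == u]|)%N.
  rewrite -sum1_card (partition_big h (mem (V :\: C))) /=; last first.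
    by move=> t; rewrite !inE => /andP[/hD -> ->].
  apply: eq_bigr => u _; rewrite -sum1_card; apply: eq_bigl => t.
  by rewrite !inE.
have [u uVC hu] : exists2 u, u \in V :\: C &
    (#|D'| <= (#|V| - k) * #|[set t in D' | h t == u]|)%N.
  apply/exists_inP; apply: contraT => /exists_inPn hlt.
  have /card_gt0P[u0 u0P] : (0 < #|V :\: C|)%N by rewrite cVC subn_gt0.
  have : (\sum_(u in V :\: C) (#|V| - k) * #|[set t in D' | h t == u]|
          < \sum_(u in V :\: C) #|D'|)%N.
    rewrite (bigD1 u0) //= [X in (_ < X)%N](bigD1 u0) //= -addSn leq_add //.
      by rewrite ltnNge hlt.
    by apply: leq_sum => u /andP[hu _]; rewrite ltnW // ltnNge hlt.
  by rewrite -big_distrr -D'E sum_nat_const cVC ltnn.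
exists (u |: C); move: uVC; rewrite inE => /andP[uC uV]; split.
- by rewrite subUset sub1set uV.
- by rewrite cardsU1 uC Ck.
set D'' := [set t in D | _].
have cD : #|D'| = (#|[set t in D' | h t == u]| + #|D''|)%N.
  rewrite -(cardsID [set t | h t == u]); congr (_ + _)%N; apply: eq_card => t;
    rewrite !inE //.
  by rewrite negb_or; case: (h t == u); rewrite /= ?andbF ?andbT.
have Vk : (0 < #|V| - k)%N by rewrite subn_gt0.
(* After multiplication by |V| - k, the bound [hC] reduces the goal to (|V| - k)|D''| <= (|V| - k -
   1)|D'|, which is [hu] rearranged. *)
rewrite -(leq_pmul2l Vk) subnS mulnCA [leqRHS]mulnCA.
apply: leq_trans (leq_mul (leqnn (#|V| - k).-1) hC).
rewrite [leqRHS]mulnCA leq_mul2l; apply/orP; right.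
rewrite -(leq_add2r ((#|V| - k) * #|[set t in D' | h t == u]|)) -mulnDr.
rewrite [X in (_ * X)%N]addnC -cD -{1}(prednK Vk) mulSn addnC leq_add2l.
exact: hu.
Qed.

(** * Codewords as Laurent polynomials, and words of minimum weight *)

Section ToricCodes.
Variable F : finFieldType.

Definition supp {r} (A : {fset 'rV[int]_r}) (c : 'rV[int]_r -> F)
    : {set torus F r} := [set p | laurent F A c p != 0].

Lemma min_distance_le (T : finType) (C : {set {ffun T -> F}}) w :
  w \in C -> w != 0 -> (min_distance C <= weight w)%N.
Proof.
by move=> wC w0; rewrite -leEnat; apply: bigmin_le_cond; rewrite wC.
Qed.

(** A nonzero word keeps the minimum from being over an empty family, and the default [#|T|] is no
    smaller than any weight. *)
Lemma min_distance_attained (T : finType) (C : {set {ffun T -> F}}) w :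
  w \in C -> w != 0 ->
  exists v, [/\ v \in C, v != 0 & min_distance C = weight v].
Proof.
move=> wC w0.
have [||v /andP[vC v0] vE] := @eq_bigmin _ nat _ #|T| w
    [pred w | (w \in C) && (w != 0)] (fun w => weight w).
- by rewrite /= wC.
- by move=> v _; rewrite leEnat max_card.
- by exists v.
Qed.

(** Exponents in the box are nonnegative, so absolute values do not change them and each monomial
    evaluates to its character. *)
Lemma mem_toric_code r (A : {fset 'rV[int]_r}) (w : {ffun torus F r -> F}) :
  (forall x, x \in A -> in_box #|F| x) ->
  w \in toric_code F A <-> exists c, w =1 laurent F A c.
Proof.
move=> hA.
have ev (c : {ffun A -> F}) p :
    evaluation (lincomb c) p = \sum_(a : A) c a * chi F (val a) p.
  rewrite ffunE rmorph_sum /=; apply: eq_bigr => a _.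
  rewrite mevalZ mevalX; congr (_ * _); apply: eq_bigr => j _.
  have /forallP/(_ j)/andP[a0 _] := hA _ (valP a).
  by rewrite mnmE exprnP gez0_abs.
split=> [/imsetP[c _ ->]|[c hc]].
  exists (fun x => oapp c 0 (insub x)) => p.
  by rewrite ev /laurent big_seq_fsetE; apply: eq_bigr => a _; rewrite valK.
apply/imsetP; exists [ffun a => c (val a)] => //.
apply/ffunP => p; rewrite ev hc /laurent big_seq_fsetE.
by apply: eq_bigr => a _; rewrite ffunE.
Qed.

Lemma toric_distance_le r (A : {fset 'rV[int]_r}) c p :
  (forall x, x \in A -> in_box #|F| x) -> laurent F A c p != 0 ->
  (toric_distance F A <= #|supp A c|)%N.
Proof.
move=> hA hp; pose w : {ffun torus F r -> F} := [ffun p => laurent F A c p].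
have -> : #|supp A c| = weight w.
  by apply: eq_card => t; rewrite !inE ffunE.
apply: min_distance_le.
  by apply/(mem_toric_code _ _ _ hA); exists c => t; rewrite ffunE.
by apply: contraNneq hp => /ffunP/(_ p); rewrite !ffunE => ->.
Qed.

Lemma toric_distance_attained r (A : {fset 'rV[int]_r}) x :
  (forall x, x \in A -> in_box #|F| x) -> x \in A ->
  exists2 c, exists p, laurent F A c p != 0 &
    toric_distance F A = #|supp A c|.
Proof.
move=> hA xA.
have [p hp] := @laurent_neq0 F r A (fun=> 1) x hA xA (oner_neq0 F).
pose w : {ffun torus F r -> F} := [ffun p => laurent F A (fun=> 1) p].
have [||v [vC v0 vE]] := @min_distance_attained _ (toric_code F A) w.
- by apply/(mem_toric_code _ _ _ hA); exists (fun=> 1) => t; rewrite ffunE.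
- by apply: contraNneq hp => /ffunP/(_ p); rewrite !ffunE => ->.
have [c hc] := (mem_toric_code _ _ v hA).1 vC.
exists c; last by rewrite /toric_distance vE; apply: eq_card => t; rewrite !inE hc.
apply/existsP; apply: contraNT v0 => /existsPn h.
by apply/eqP/ffunP => t; rewrite hc ffunE; apply/eqP/negPn/h.
Qed.

(** * Splitting off the last variable *)

Definition row_snoc {n} (y : 'rV[int]_n) (i : int) : 'rV[int]_n.+1 :=
  \row_j oapp (y 0) i (unlift ord_max j).

Lemma last_row_snoc n (y : 'rV[int]_n) i : last_coord (row_snoc y i) = i.
Proof. by rewrite /last_coord mxE unlift_none. Qed.

Lemma col'_row_snoc n (y : 'rV[int]_n) i : col' ord_max (row_snoc y i) = y.
Proof. by apply/rowP => j; rewrite !mxE liftK. Qed.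

Lemma row_snocK n (x : 'rV[int]_n.+1) :
  row_snoc (col' ord_max x) (last_coord x) = x.
Proof.
apply/rowP => j; rewrite mxE.
by case: unliftP => [k ->|->] //=; rewrite mxE.
Qed.

Lemma mem_fiber n (S : {fset 'rV[int]_n.+1}) i y :
  (y \in fiber S i) = (row_snoc y i \in S).
Proof.
apply/imfsetP/idP => [[x /= /andP[xS /eqP <-] ->]|yS]; first by rewrite row_snocK.
exists (row_snoc y i); last by rewrite col'_row_snoc.
by rewrite !inE yS last_row_snoc /=.
Qed.

Definition torus_snoc {n} (p : torus F n) (u : {unit F}) : torus F n.+1 :=
  [ffun j => oapp p u (unlift ord_max j)].

Lemma chi_snoc n (y : 'rV[int]_n) i (p : torus F n) u :
  chi F (row_snoc y i) (torus_snoc p u) = chi F y p * val u ^ i.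
Proof.
rewrite /chi (bigD1_ord ord_max) //= mulrC mxE ffunE unlift_none /=.
by congr (_ * _); apply: eq_bigr => j _; rewrite mxE ffunE liftK.
Qed.

Lemma card_torus_snoc n (P : pred (torus F n.+1)) :
  #|[set p | P p]| = (\sum_p #|[set u | P (torus_snoc p u)]|)%N.
Proof.
rewrite -sum1_card (reindex (fun z : torus F n * {unit F} => torus_snoc z.1 z.2)) /=.
  under [RHS]eq_bigr do rewrite -sum1_card.
  by rewrite pair_big_dep /=; apply: eq_bigl => z; rewrite !inE.
exists (fun p : torus F n.+1 => ([ffun j => p (lift ord_max j)] : torus F n, p ord_max)).
  move=> [p u] _ /=; rewrite ffunE unlift_none; congr (_, _).
  by apply/ffunP => j; rewrite !ffunE liftK.
move=> p _; apply/ffunP => j; rewrite ffunE.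
by case: unliftP => [k ->|->] //=; rewrite ffunE.
Qed.

(** The polynomial in t_m left after specializing the other variables at [p]; its i-th coefficient
    is f_i(p). *)
Definition fiber_poly n (S : {fset 'rV[int]_n.+1}) l c (p : torus F n) : {poly F} :=
  \poly_(i < l.+1) laurent F (fiber S i%:Z) (fun y => c (row_snoc y i%:Z)) p.

Lemma laurent_snoc n (S : {fset 'rV[int]_n.+1}) l c p u :
  (forall x, x \in S -> 0 <= last_coord x <= l%:Z) ->
  laurent F S c (torus_snoc p u) = (fiber_poly n S l c p).[val u].
Proof.
move=> hl; rewrite horner_poly.
pose G x := c x * chi F x (torus_snoc p u).
transitivity (\sum_(i < l.+1) \sum_(x <- S | last_coord x == i%:Z) G x).
  under [RHS]eq_bigr do rewrite big_mkcond.
  rewrite exchange_big /= /laurent big_seq [RHS]big_seq.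
  apply: eq_bigr => x /hl; case: (last_coord x) => // k; rewrite lez_nat => kl.
  by rewrite -big_mkcond /= (big_pred1 (Ordinal (kl : (k < l.+1)%N))).
apply: eq_bigr => i _; rewrite /laurent mulr_suml.
transitivity (\sum_(x <- [fset row_snoc y i%:Z | y in fiber S i%:Z]%fset) G x).
  rewrite -big_filter; apply/perm_big/uniq_perm; rewrite ?filter_uniq ?fset_uniq //.
  move=> x; rewrite mem_filter; apply/andP/imfsetP => [[/eqP xi xS]|[y /= hy ->]].
    by exists (col' ord_max x); rewrite /= ?mem_fiber -xi row_snocK.
  by rewrite last_row_snoc eqxx -mem_fiber.
rewrite big_imfset /=.
  by apply: eq_bigr => y _; rewrite /G chi_snoc mulrA.
move=> y z _ _ /(congr1 (fun x => col' ord_max x)).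
by rewrite !col'_row_snoc.
Qed.

(** At most k of the q-1 units are roots. *)
Lemma card_nonroots (P : {poly F}) k : (size P <= k.+1)%N -> P != 0 ->
  (#|F| - 1 - k <= #|[set u : {unit F} | P.[val u] != 0%R]|)%N.
Proof.
move=> sP P0.
set Z := [set u : {unit F} | P.[val u] == 0].
have -> : [set u : {unit F} | P.[val u] != 0] = ~: Z by apply/setP => u; rewrite !inE.
rewrite subn1 -card_finField_unit cardsT -(cardsC Z).
rewrite leq_subLR leq_add2r -ltnS; apply: leq_trans sP.
rewrite cardE -(size_map val); apply: max_poly_roots => //.
  apply/allP => x /mapP[u]; rewrite mem_enum inE => uZ ->.
  by rewrite rootE.
by rewrite map_inj_uniq ?enum_uniq //; apply: val_inj.
Qed.

(* Multiplying by [prod_(g in s) (t^b - g t^a)], up to translation. *)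
Lemma fiber_descent n (S : {fset 'rV[int]_n.+1}) l (a b : 'rV[int]_n) :
  a != b ->
  (forall i : nat, (1 <= i <= l)%N -> exists v : 'rV[int]_n,
     (minkowski (minkowski (fiber S i%:Z) [fset a; b]) [fset v]
       `<=` fiber S (i%:Z - 1)%R)%fset) ->
  forall (s : seq F) c, (size s <= l)%N -> 0 \notin s ->
  (exists2 y, y \in fiber S (size s)%:Z & c y != 0) ->
  exists2 d, exists2 y, y \in fiber S 0 & d y != 0 &
    forall p, laurent F (fiber S 0) d p != 0 ->
      laurent F (fiber S (size s)%:Z) c p != 0 /\ chi F b p / chi F a p \notin s.
Proof.
move=> ab hfib; elim=> [|g s IH] c; first by move=> _ _ hc; exists c.
rewrite [size (g :: s)]/= => sl.
rewrite inE negb_or eq_sym => /andP[g0 s0] hc.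
have [v hv] := hfib (size s).+1 sl.
have e : (size s).+1%:Z - 1 = (size s)%:Z by rewrite intS addrAC subrr add0r.
rewrite e in hv.
have mv x z : x \in fiber S (size s).+1%:Z -> z \in [fset a; b]%fset ->
    x + z + v \in fiber S (size s)%:Z.
  move=> xS zab; apply: (fsubsetP hv).
  by apply: in_imfset2 => /=; [apply: in_imfset2 | apply: fset11].
(* The binomial for the head [g] moves from the fiber of index |s|+1 to that of index |s|; the
   induction hypothesis handles the rest. *)
have [|d hd dE] := @mul_binomial F n _ (fiber S (size s)%:Z) a b v c g ab g0 _ hc.
  by move=> x xS; split; apply: mv => //; [apply: fset21 | apply: fset22].
have [d' hd' d'E] := IH d (ltnW sl) s0 hd.
exists d'; first exact: hd'.
(* A nonzero product has all factors nonzero, and chi b - g chi a <> 0 says that the ratio differs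
   from g. *)
move=> p /d'E[]; rewrite dE 2!mulf_eq0 2!negb_or => /andP[/andP[_ h1] h2 h3].
split; first exact: h2.
rewrite inE negb_or h3 andbT; apply: contra h1 => /eqP <-.
by rewrite divfK ?subrr // chi_neq0.
Qed.

End ToricCodes.

(** * Comparing the distances of [S] and its bottom fiber *)

Theorem theorem3p5 (R : realFieldType) (F : finFieldType) (n : nat)
    (hn : (1 <= n)%N) (S : {fset 'rV[int]_n.+1})
    (hS : forall x, x \in S -> in_box #|F| x)
    (l : nat)
    (hl : forall k : int, (k \in (@last_coord n @` S)%fset) = (0 <= k <= l%:Z))
    (a b : 'rV[int]_n) (hab : primitive_segment R a b)
    (hfib : forall i : nat, (1 <= i <= l)%N ->
       exists v : 'rV[int]_n,
         (minkowski (minkowski (fiber S i%:Z) [fset a; b]) [fset v]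
            `<=` fiber S (i%:Z - 1)%R)%fset) :
  toric_distance F S = ((#|F| - 1) * toric_distance F (fiber S 0))%N.
Proof.
have hl' x : x \in S -> 0 <= last_coord x <= l%:Z.
  by move=> xS; rewrite -hl; apply/imfsetP; exists x.
(* The point of [S] at height l lies in the box; the bound ensures that k <= l values can be picked
   among the q-1 units. *)
have lq : (l <= #|F| - 1)%N.
  have /imfsetP[x /= /hS/forallP/(_ ord_max)/andP[_ xq] lx] :
    l%:Z \in (@last_coord n @` S)%fset by rewrite hl lexx andbT.
  move: xq; rewrite -[x _ _]/(last_coord x) -lx => lq2.
  have q0 : (1 <= #|F|)%N by apply/card_gt0P; exists 0.
  rewrite -lez_nat -subzn //; apply: le_trans lq2 _.
  by rewrite lerD2l lerN2.
have hS0 y : y \in fiber S 0 -> in_box #|F| y.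
  rewrite mem_fiber => /hS/forallP hy; apply/forallP => j.
  by have := hy (lift ord_max j); rewrite mxE liftK.
have [x0 x0S x00] : exists2 x, x \in S & last_coord x = 0.
  have /imfsetP[x /= xS e] : 0 \in (@last_coord n @` S)%fset by rewrite hl lexx.
  by exists x.
have y0S : col' ord_max x0 \in fiber S 0 by rewrite mem_fiber -x00 row_snocK.
have cardU : #|{: {unit F}}| = (#|F| - 1)%N.
  by rewrite -cardsT card_finField_unit subn1.
apply/eqP; rewrite eqn_leq; apply/andP; split.
  have [c [p hp] ->] := toric_distance_attained F _ _ _ hS0 y0S.
  (* Upper bound: a minimal word for S_0, read as constant in t_m, has its weight multiplied by
     q-1. *)
  pose c' x := if last_coord x == 0 then c (col' ord_max x) else 0.
  have c'E q u : laurent F S c' (torus_snoc F q u) = laurent F (fiber S 0) c q.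
    rewrite (laurent_snoc F _ _ l) // horner_poly big_ord_recl /= expr0 mulr1.
    rewrite big1 ?addr0.
      by apply: eq_bigr => y _; rewrite /c' last_row_snoc eqxx col'_row_snoc.
    move=> i _; rewrite /laurent big1 ?mul0r // => y _.
    by rewrite /c' last_row_snoc mul0r.
  apply: leq_trans (toric_distance_le F _ _ c' (torus_snoc F p 1%g) hS _) _.
    by rewrite c'E.
  rewrite /supp card_torus_snoc (bigID (mem (supp F (fiber S 0) c))) /=.
  rewrite [X in (_ + X)%N]big1 ?addn0.
    rewrite mulnC -sum_nat_const -cardU; apply: leq_sum => q _.
    exact: max_card.
  move=> q; rewrite inE negbK => /eqP hq.
  by apply: eq_card0 => u; rewrite !inE c'E hq eqxx.
have [c [p hp] ->] := toric_distance_attained F _ _ _ hS x0S.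
(* Lower bound: the largest index satisfying [top] is the degree of f in t_m. *)
pose top k := (k <= l)%N && has (fun y => c (row_snoc y k%:Z) != 0) (fiber S k%:Z).
have [x xS cx] : exists2 x, x \in S & c x != 0.
  suff /hasP[x xS cx] : has (fun x => c x != 0) S by exists x.
  apply: contraNT hp => /hasPn h; rewrite /laurent big_seq big1 // => x /h.
  by rewrite negbK => /eqP ->; rewrite mul0r.
have ex_top : exists k, top k.
  have := hl' _ xS; case xk: (last_coord x) => [k|//]; rewrite lez_nat => kl.
  exists k; rewrite /top (kl : (k <= l)%N); apply/hasP; exists (col' ord_max x).
    by rewrite mem_fiber -xk row_snocK.
  by rewrite -xk row_snocK.
have top_le k : top k -> (k <= l)%N by case/andP.
have [k /andP[kl /hasP[y yk cy]] kmax] := ex_maxnP ex_top top_le.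
pose ck y := c (row_snoc y k%:Z).
set D := supp F (fiber S k%:Z) ck.
pose V : {set F} := [set~ 0].
have cV : #|V| = (#|F| - 1)%N by rewrite cardsC1 subn1.
(* The k values of t^(b-a) to be killed are chosen so that at most a fraction (q-1-k)/(q-1) of the
   support [D] of f_k survives. *)
have [||C [CV Ck hC]] := @avoid_values _ _ (fun q => chi F b q / chi F a q) D V k.
- by move=> q _; rewrite !inE mulf_neq0 ?invr_eq0 ?chi_neq0.
- by rewrite cV (leq_trans kl).
have sC : size (enum C) = k by rewrite -cardE.
have [|||d [z zS dz] dE] :=
    @fiber_descent F _ _ _ _ _ hab.1 hfib (enum C) ck.
- by rewrite sC.
- by rewrite mem_enum; apply/negP => /(subsetP CV); rewrite !inE eqxx.
- by rewrite sC; exists y.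
rewrite sC in dE.
(* A nonzero coefficient gives a nonzero word, so [d] bounds d(S_0) from above. *)
have [q hq] := laurent_neq0 F _ _ _ _ hS0 zS dz.
have d0 : (toric_distance F (fiber S 0) <=
    #|[set q in D | chi F b q / chi F a q \notin C]|)%N.
  apply: leq_trans (toric_distance_le F _ _ _ _ hS0 hq) _.
  apply/subset_leq_card/subsetP => t; rewrite !inE => /dE[-> ].
  by rewrite mem_enum.
rewrite -cV; apply: leq_trans (leq_mul (leqnn _) d0) _.
apply: leq_trans hC _; rewrite cV /supp card_torus_snoc mulnC -sum_nat_const.
(* Only base points in [D] are kept; each contributes at least q-1-k. *)
rewrite [leqRHS](bigID (mem D)) /=; apply: leq_trans (leq_addr _ _).
apply: leq_sum => t; rewrite inE => ht.
pose P := fiber_poly F n S l c t.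
have -> : [set u | laurent F S c (torus_snoc F t u) != 0] =
    [set u : {unit F} | P.[val u] != 0].
  by apply/setP => u; rewrite !inE (laurent_snoc F _ _ l).
apply: card_nonroots.
  (* Maximality of [k] makes every coefficient above degree k vanish. *)
  apply/leq_sizeP => j kj; rewrite coef_poly; case: ifP => // jl.
  rewrite /laurent big_seq big1 // => w wS; apply/eqP; rewrite mulf_eq0.
  apply/orP; left; apply: contraLR kj => cw; rewrite -leqNgt; apply: kmax.
  by rewrite /top -ltnS jl; apply/hasP; exists w.
(* The coefficient of degree k is f_k(t), nonzero because [t] lies in [D]. *)
apply: contraNneq ht => P0; rewrite -[laurent _ _ _ _](_ : P`_k = _).
  by rewrite P0 coef0.
by rewrite coef_poly ltnS kl.
Qed.
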